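(* Let $k,l\ge 1$, let $X\subseteq\mathcal C^k$ be meager-additive, and let $Y\subseteq\mathcal C^l$ have strong measure zero. Then $X\times Y\subseteq\mathcal C^{k+l}$ has strong measure zero.
   Context: $\mathcal C=\{0,1\}^{\mathbb N}$ (with $\mathbb N=\{0,1,2,\dots\}$) is the Cantor space with the product topology and the metric $d(x,y)=\frac{1}{N(x,y)+1}$ for $x\ne y$, where $N(x,y)=\min\{n: x(n)\neq y(n)\}$, and $d(x,x)=0$. For $k\ge 1$, $\mathcal C^k$ carries the metric $d_k$ which is the maximum of the coordinatewise distances; $\mathcal C^k\times\mathcal C^l$ is identified with $\mathcal C^{k+l}$. $\oplus$ denotes coordinatewise addition modulo 2 on $\mathcal C$, and the induced group operation on $\mathcal C^k$; for $A,B\subseteq\mathcal C^k$, $A\oplus B=\{a\oplus b: a\in A,\ b\in B\}$. A set $X\subseteq\mathcal C^k$ is meager-additive if for each meager (first category) $M\subseteq\mathcal C^k$, $X\oplus M$ is meager in $\mathcal C^k$. A metric space $X$ has strong measure zero if for each sequence $\{\epsilon_n\}_{n\in\mathbb N}$ of positive reals there is a cover $\{I_n\}_{n\in\mathbb N}$ of $X$ such that $\operatorname{diam}(I_n)<\epsilon_n$ for all $n$. Subsets of $\mathcal C^k$ are considered with the metric $d_k$. *)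

(* Defs.v *)
From HB Require Import structures.
From mathcomp Require Import all_boot all_order all_algebra finmap.
From mathcomp Require Import all_classical all_reals all_analysis.

Set Implicit Arguments.
Unset Strict Implicit.
Unset Printing Implicit Defensive.

Import Order.TTheory GRing.Theory Num.Theory.

Local Open Scope classical_set_scope.
Local Open Scope ring_scope.

Section prod_entourage.
Context {I : Type} {T : I -> uniformType}.
Local Notation P := (prod_topology T).

Lemma entourage_proj i (V : set (T i * T i)) : entourage V ->
  @entourage P [set xy | V (xy.1 i, xy.2 i)].
Proof.
move=> entV; pose W := [set xy : P * P | V (xy.1 i, xy.2 i)].
have entW : @entourage (initial_topology (@proj _ T i)) W by exists V.
exists W => //.
pose ent_of (p : {classic I} * set (P * P)) := `[< @entourage
  (Uniform.Pack (Uniform.class (initial_topology (@proj _ T p.1)))) p.2 >].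
have eW : ent_of (i, W) by apply/asboolP.
pose w : {p | ent_of p} := exist ent_of (i, W) eW.
exists [fset w]%fset; first by move=> ? ?; exact: in_setT.
rewrite eqEsubset; split => xy /=.
  by move=> /(_ w); apply; rewrite /= inE.
by move=> ? ? /=; rewrite inE => /eqP ->.
Qed.

Lemma entourage_prod_sub (G : set_system (P * P)) : Filter G ->
  (forall i V, entourage V -> G [set xy | V (xy.1 i, xy.2 i)]) ->
  @entourage P `<=` G.
Proof.
move=> FG H A [B [F _ <-]] BA; apply: filterS BA _.
apply: filter_bigI => -[[i W] /= eW] _.
have /asboolP /= [V entV VW] := eW.
by apply: filterS VW _; exact: H.
Qed.

End prod_entourage.

Section cantor_metric.
Variable R : realType.
Implicit Types x y z : cantor_space.

Definition cantor_dist x y : R :=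
  if pselect (exists n, x n != y n) is left xy then (ex_minn xy).+1%:R^-1
  else 0.

Lemma cantor_dist_ge0 x y : 0 <= cantor_dist x y.
Proof. by rewrite /cantor_dist; case: pselect => // ?; rewrite invr_ge0. Qed.

Lemma cantor_dist_lt x y n :
  cantor_dist x y < n.+1%:R^-1 <-> forall m, (m <= n)%N -> x m = y m.
Proof.
rewrite /cantor_dist; case: pselect => [xy|nxy]; last first.
  split=> [_ m _|_]; last by rewrite invr_gt0.
  by apply/eqP; apply: contrapT => /negP xy; apply: nxy; exists m.
case: ex_minnP => N xyN minN.
rewrite ltf_pV2 ?posrE// ltr_nat ltnS; split=> [nN m mn|H].
  by apply/eqP; apply: contraTT mn => /minN Nm; rewrite -ltnNge (leq_trans nN).
by rewrite ltnNge; apply/negP => /H /eqP; rewrite (negbTE xyN).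
Qed.

Lemma cantor_dist_refl x : cantor_dist x x = 0.
Proof.
rewrite /cantor_dist; case: pselect => // xx; exfalso.
by case: xx => n; rewrite eqxx.
Qed.

Lemma cantor_dist_sym x y : cantor_dist x y = cantor_dist y x.
Proof.
rewrite /cantor_dist; case: pselect => [xy|nxy]; case: pselect => [yx|nyx] //.
- congr (_.+1%:R^-1); by apply: eq_ex_minn => n /=; rewrite eq_sym.
- by case: nyx; case: xy => n; exists n; rewrite eq_sym.
- by case: nxy; case: yx => n; exists n; rewrite eq_sym.
Qed.

Lemma cantor_dist_ultra x y z :
  cantor_dist x z <= Num.max (cantor_dist x y) (cantor_dist y z).
Proof.
rewrite {1}/cantor_dist; case: pselect => [xz|_]; last first.
  by rewrite le_max cantor_dist_ge0.
case: ex_minnP => N xzN _; rewrite leNgt gt_max; apply/negP.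
move=> /andP[/cantor_dist_lt xy /cantor_dist_lt yz].
by move/eqP: xzN; apply; rewrite xy // yz.
Qed.

Lemma cantor_dist_eq0 x y : cantor_dist x y = 0 -> x = y.
Proof.
move=> xy0; apply: functional_extensionality_dep => n.
by apply: (cantor_dist_lt x y n).1 => //; rewrite xy0 invr_gt0.
Qed.

Definition cantor_ball x (e : R) : set cantor_space :=
  [set y | cantor_dist x y < e].

Lemma cantor_ball_center x (e : R) : 0 < e -> cantor_ball x e x.
Proof. by move=> e0; rewrite /cantor_ball /= cantor_dist_refl. Qed.

Lemma cantor_ball_sym x y (e : R) : cantor_ball x e y -> cantor_ball y e x.
Proof. by rewrite /cantor_ball /= cantor_dist_sym. Qed.

Lemma cantor_ball_triangle x y z (e1 e2 : R) :
  cantor_ball x e1 y -> cantor_ball y e2 z -> cantor_ball x (e1 + e2) z.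
Proof.
rewrite /cantor_ball /= => xy yz; apply: le_lt_trans (cantor_dist_ultra x y z) _.
have e1_gt0 := le_lt_trans (cantor_dist_ge0 x y) xy.
have e2_gt0 := le_lt_trans (cantor_dist_ge0 y z) yz.
by rewrite gt_max (lt_le_trans xy) ?lerDl ?ltW// (lt_le_trans yz) ?lerDr ?ltW.
Qed.

Lemma cantor_entourageE :
  @entourage cantor_space = entourage_ cantor_ball.
Proof.
rewrite eqEsubset; split.
- apply: entourage_prod_sub.
    apply: filter_from_filter; first by exists 1 => /=.
    move=> e f e0 f0; exists (Num.min e f); first by rewrite /= lt_min e0.
    by move=> xy; rewrite /cantor_ball /= lt_min => /andP[].
  move=> n V entV; exists n.+1%:R^-1; first by rewrite /= invr_gt0.
  move=> [x y]; rewrite /cantor_ball /= => /cantor_dist_lt -> //.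
  exact: entourage_refl.
- move=> A [e /= e0 eA].
  have [n ne] : exists n, n.+1%:R^-1 <= e.
    exists (Num.truncn e^-1); rewrite invf_ple ?posrE //.
    by apply: ltW; apply: truncnS_gt.
  suff entn : entourage [set xy : cantor_space * cantor_space |
      forall m, (m <= n)%N -> xy.1 m = xy.2 m].
    apply: filterS entn => -[x y] /cantor_dist_lt xyn.
    exact/eA/(lt_le_trans xyn).
  have entm m : entourage [set xy : cantor_space * cantor_space |
      xy.1 m = xy.2 m].
    apply: (@entourage_proj _ (fun=> bool) m [set b | b.1 = b.2]).
    by rewrite uniform_discrete => _ [b _ <-].
  elim: n {ne} => [|n IHn].
    by apply: filterS (entm 0%N) => xy xy0 [|m].
  apply: filterS2 IHn (entm n.+1) => xy xyn xySn m.
  by rewrite leq_eqVlt => /predU1P[->//|]; exact: xyn.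
Qed.
End cantor_metric.

HB.instance Definition _ (R : realType) :=
  Uniform_isPseudoMetric.Build R cantor_space (@cantor_ball_center R)
    (@cantor_ball_sym R) (@cantor_ball_triangle R) (cantor_entourageE R).

HB.instance Definition _ (R : realType) :=
  PseudoMetric_isMetric.Build R cantor_space (@cantor_dist_ge0 R)
    (@cantor_dist_eq0 R) (fun _ _ => erefl).

Definition cantor_pow (k : nat) : Type :=
  prod_topology (fun _ : 'I_k => cantor_space).

HB.instance Definition _ k := Pointed.on (cantor_pow k).
HB.instance Definition _ k := Uniform.on (cantor_pow k).

Section cantor_pow_metric.
Variables (R : realType) (k : nat).
Implicit Types x y z : cantor_pow k.

Definition cantor_pow_dist x y : R :=
  \big[Num.max/0]_(i < k) mdist (x i) (y i).

Lemma cantor_pow_dist_lt x y (e : R) : 0 < e ->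
  cantor_pow_dist x y < e <-> forall i, mdist (x i) (y i) < e.
Proof.
move=> e0; split=> [/bigmax_ltP[_ H] i|H]; first exact: H.
by apply/bigmax_ltP; split.
Qed.

Lemma cantor_pow_dist_ge0 x y : 0 <= cantor_pow_dist x y.
Proof. exact: bigmax_ge_id. Qed.

Lemma cantor_pow_dist_eq0 x y : cantor_pow_dist x y = 0 -> x = y.
Proof.
move=> xy0; apply: functional_extensionality_dep => i.
apply: (@mdist_positivity R); apply: le_anti; rewrite mdist_ge0 andbT -xy0.
exact: le_bigmax.
Qed.

Definition cantor_pow_ball x (e : R) : set (cantor_pow k) :=
  [set y | cantor_pow_dist x y < e].

Lemma cantor_pow_ball_center x (e : R) : 0 < e -> cantor_pow_ball x e x.
Proof.
by move=> e0; apply/cantor_pow_dist_lt => // i; rewrite mdistxx.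
Qed.

Lemma cantor_pow_ball_sym x y (e : R) :
  cantor_pow_ball x e y -> cantor_pow_ball y e x.
Proof.
rewrite /cantor_pow_ball /= => xy.
have e0 := le_lt_trans (cantor_pow_dist_ge0 x y) xy.
apply/cantor_pow_dist_lt => // i; rewrite metric_sym.
exact: (cantor_pow_dist_lt x y e0).1.
Qed.

Lemma cantor_pow_ball_triangle x y z (e1 e2 : R) :
  cantor_pow_ball x e1 y -> cantor_pow_ball y e2 z ->
  cantor_pow_ball x (e1 + e2) z.
Proof.
rewrite /cantor_pow_ball /= => xy yz.
have e10 := le_lt_trans (cantor_pow_dist_ge0 x y) xy.
have e20 := le_lt_trans (cantor_pow_dist_ge0 y z) yz.
apply/cantor_pow_dist_lt => [|i]; first exact: addr_gt0.
apply: le_lt_trans (metric_triangle (x i) (y i) (z i)) _.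
by rewrite ltrD//; [exact: (cantor_pow_dist_lt x y e10).1|
                    exact: (cantor_pow_dist_lt y z e20).1].
Qed.

Lemma cantor_pow_entourageE :
  @entourage (cantor_pow k) = entourage_ cantor_pow_ball.
Proof.
rewrite eqEsubset; split.
- apply: entourage_prod_sub.
    apply: filter_from_filter; first by exists 1 => /=.
    move=> e f e0 f0; exists (Num.min e f); first by rewrite /= lt_min e0.
    by move=> xy; rewrite /cantor_pow_ball /= lt_min => /andP[].
  move=> i V; rewrite -(@entourage_ballE R) => -[e /= e0 eV].
  exists e => // -[x y] /= xy; apply: eV.
  exact: (cantor_pow_dist_lt x y e0).1.
- move=> A [e /= e0 eA].
  have ente i : entourage [set xy : cantor_pow k * cantor_pow k |
      mdist (xy.1 i) (xy.2 i) < e].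
    apply: (@entourage_proj _ (fun=> cantor_space) i
      [set b | mdist b.1 b.2 < e]).
    rewrite -(@entourage_ballE R); by exists e.
  have entA : entourage [set xy : cantor_pow k * cantor_pow k |
      forall i, mdist (xy.1 i) (xy.2 i) < e].
    exact: (@filter_forall (cantor_pow k * cantor_pow k) _
      (fun i xy => mdist (xy.1 i) (xy.2 i) < e) _ entourage_filter ente).
  apply: filterS entA => -[x y] xy.
  exact/eA/cantor_pow_dist_lt.
Qed.

End cantor_pow_metric.

HB.instance Definition _ (R : realType) k :=
  Uniform_isPseudoMetric.Build R (cantor_pow k) (@cantor_pow_ball_center R k)
    (@cantor_pow_ball_sym R k) (@cantor_pow_ball_triangle R k)
    (cantor_pow_entourageE R k).

HB.instance Definition _ (R : realType) k :=
  PseudoMetric_isMetric.Build R (cantor_pow k) (@cantor_pow_dist_ge0 R k)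
    (@cantor_pow_dist_eq0 R k) (fun _ _ => erefl).

Definition cantor_concat k l (xy : cantor_pow k * cantor_pow l) :
    cantor_pow (k + l) :=
  fun i => match fintype.split i with inl a => xy.1 a | inr b => xy.2 b end.

Definition cantor_xor k (x y : cantor_pow k) : cantor_pow k :=
  fun i n => x i n (+) y i n.

Definition nowhere_dense (T : topologicalType) (A : set T) :=
  interior (closure A) = set0.

Definition meager (T : topologicalType) (A : set T) :=
  exists F : nat -> set T,
    (forall n, nowhere_dense (F n)) /\ A = \bigcup_n F n.

Definition meager_additive k (X : set (cantor_pow k)) :=
  forall M : set (cantor_pow k), meager M ->
    meager [set cantor_xor x m | x in X & m in M].

(* The supremum of the empty set is -oo; the maximum with 0 makes the diameter
   of the empty set 0. *)
Definition diam (R : realType) (T : metricType R) (A : set T) : \bar R :=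
  maxe 0%E (ereal_sup [set (mdist x y)%:E | x in A & y in A]).

(* X is regarded as a metric space with the metric inherited from T, so that
   the sets covering X are subsets of X. *)
Definition strong_measure_zero (R : realType) (T : metricType R) (X : set T) :=
  forall eps : nat -> R, (forall n, 0 < eps n) ->
    exists I : nat -> set T,
      X = \bigcup_n I n /\ forall n, (diam (I n) < (eps n)%:E)%E.

Arguments strong_measure_zero R {T} X.

(* Main.v *)
Require Import Defs.
From mathcomp Require Import all_boot all_order all_algebra.
From mathcomp Require Import all_classical all_reals all_analysis.

(** Strong measure zero is used in combinatorial form: for every height
function [h] there are cylinders of heights [h 0], [h 1], ... covering the set
([strong_measure_zeroP]).

The property of [X] that makes the theorem work is a matching property
([meager_additive_match]): for every partition of the positions into intervals
[[f j, f j.+1)] there are a single point [w] and a grouping of the intervals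
into consecutive blocks such that every [x] in [X] agrees with [w] on some
interval of all but finitely many blocks.  It comes from applying meager
additivity to the meager set of points that are eventually nonzero on every
interval, together with the fact that any meager set misses a set of the form
[{z | z agrees with w on infinitely many blocks}] ([meager_avoid]).

Given target heights [h], let [f] grow so fast that [f j.+1] exceeds all the
heights allotted to interval [j], one for each of the finitely many prefixes
of length [f j] and each block index [n <= j].  If [x] agrees with [w] on
interval [j] and has the prefix [s] below [f j], then [x] lies in the cylinder
of height [f j.+1] around [s] continued by [w].  The set [Y] is covered by
cylinders [t n], one for each block, as long as the end of block [n], in such
a way that every point of [Y] lies in infinitely many of them
([cylinder_null_io]).  For [(x, y)] in [X * Y] there is thus a block [n] with
[y] in [t n] and [x] matching [w] on an interval of block [n]: all but finitely
many blocks are good for [x], infinitely many for [y].  The products of the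
corresponding cylinders cover [X * Y] with the required heights
([cylinder_null_concat]). *)

Set Implicit Arguments.
Unset Strict Implicit.
Unset Printing Implicit Defensive.

Import Order.TTheory GRing.Theory Num.Theory.

Local Open Scope classical_set_scope.

(** * Cylinders *)

Definition eq_on k (a b : nat) (x y : cantor_pow k) :=
  forall i m, (a <= m < b)%N -> x i m = y i m.

Lemma eq_on_sub k a b a' b' (x y : cantor_pow k) :
  (a <= a')%N -> (b' <= b)%N -> eq_on a b x y -> eq_on a' b' x y.
Proof.
move=> aa bb xy i m /andP[am mb]; apply: xy.
by rewrite (leq_trans aa am) (leq_trans mb bb).
Qed.

Definition splice k (a : nat) (x y : cantor_pow k) : cantor_pow k :=
  fun i m => if (m < a)%N then x i m else y i m.

Lemma eq_on_splicel k a (x y : cantor_pow k) : eq_on 0 a x (splice a x y).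
Proof. by move=> i m /andP[_ ma]; rewrite /splice ma. Qed.

(** Finitely many representatives, padded with zeros, of all the initial
segments of length [a]. *)
Definition prefixes k (a : nat) : seq (cantor_pow k) :=
  [seq (fun i m => oapp (fun m' : 'I_a => u (i, m')) false (insub m))
     | u : {ffun 'I_k * 'I_a -> bool}].

Lemma prefixesP k a (x : cantor_pow k) : exists2 i,
  (i < size (prefixes k a))%N & eq_on 0 a x (nth point (prefixes k a) i).
Proof.
pose u := [ffun p : 'I_k * 'I_a => x p.1 p.2].
exists (index u (enum {ffun 'I_k * 'I_a -> bool})).
  by rewrite size_map index_mem mem_enum.
rewrite (nth_map u) ?index_mem ?mem_enum// nth_index ?mem_enum//.
move=> i m /andP[_ ma]; case: insubP => [m' _ m'm|/negP//].
by rewrite /= ffunE -m'm.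
Qed.

Lemma mdist_eq_on (R : realType) k n (x y : cantor_pow k) :
  (mdist x y < n.+1%:R^-1 :> R)%R <-> eq_on 0 n.+1 x y.
Proof.
have n0 : (0 < n.+1%:R^-1 :> R)%R by rewrite invr_gt0.
split=> [/(cantor_pow_dist_lt x y n0) xy i m /= mn|xy].
  by move/(cantor_dist_lt R): (xy i) => /(_ m mn).
apply/(cantor_pow_dist_lt x y n0) => i.
by apply/(cantor_dist_lt R (x i) (y i) n) => m mn; exact: xy.
Qed.

Lemma invn_lt (R : realType) (e : R) : (0 < e)%R ->
  exists n, (n.+1%:R^-1 < e)%R.
Proof.
move=> e0; exists (Num.truncn e^-1).
by rewrite invf_plt ?posrE//; exact: truncnS_gt.
Qed.

(** The neighbourhood filter is read off the metric, hence the parameter [R],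
though cylinders describe it independently of [R]. *)
Lemma nbhs_eq_on (R : realType) k (x : cantor_pow k) (A : set (cantor_pow k)) :
  nbhs x A <-> exists n, forall y, eq_on 0 n x y -> A y.
Proof.
rewrite -(@nbhs_ballE R); split=> [[e /= e0 eA]|[n nA]].
  have [n ne] := invn_lt e0.
  exists n.+1 => y /(mdist_eq_on R) xy.
  by apply: eA; exact: lt_trans xy ne.
exists n.+1%:R^-1%R; first by rewrite /= invr_gt0.
by move=> y /(mdist_eq_on R) /(@eq_on_sub _ 0 n.+1 0 n) xy; exact/nA/xy.
Qed.

Lemma nowhere_denseP (R : realType) k (A : set (cantor_pow k)) :
  nowhere_dense A <-> forall x n, exists y m, eq_on 0 n x y /\
    forall z, eq_on 0 m y z -> ~ A z.
Proof.
split=> [A0 x n|H].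
  apply: contrapT => nH.
  suff : interior (closure A) x by rewrite A0.
  apply/(nbhs_eq_on R); exists n => y xy B /(nbhs_eq_on R)[m mB].
  apply: contrapT => AB; apply: nH; exists y, m; split=> // z yz Az.
  by apply: AB; exists z; split=> //; exact: mB.
rewrite /nowhere_dense -subset0 => x /(nbhs_eq_on R)[n nA].
have [y [m [xy yA]]] := H x n.
have [|z [Az /yA]] := nA y xy [set z | eq_on 0 m y z]; last exact.
by apply/(nbhs_eq_on R); exists m.
Qed.

(** * Strong measure zero through cylinders *)

Definition cylinder_null k (Y : set (cantor_pow k)) :=
  forall h : nat -> nat, exists c : nat -> cantor_pow k,
    forall y, Y y -> exists n, eq_on 0 (h n) (c n) y.

(** Distances below [1 / (n + 1)] mean agreement on the first [n + 1]
positions, so sets of small diameter and cylinders refine one another. *)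
Lemma strong_measure_zeroP (R : realType) k (Y : set (cantor_pow k)) :
  strong_measure_zero R Y <-> cylinder_null Y.
Proof.
split=> [Y0 h|Y0 eps eps0].
  have [|I [YI dI]] := Y0 (fun n => (h n).+1%:R^-1%R).
    by move=> n; rewrite invr_gt0.
  (* Centres are picked in the pieces; an empty piece gets a default one. *)
  exists (fun n => xget point (I n)) => y; rewrite YI => -[n _ Iy].
  exists n; apply: (@eq_on_sub _ 0 (h n).+1) => //; apply/(mdist_eq_on R).
  rewrite -lte_fin; apply: le_lt_trans (dI n).
  rewrite /diam le_max; apply/orP; right.
  apply: ereal_sup_ubound; exists (xget point (I n)); last by exists y.
  by apply: (xgetPex point); exists y.
have /choice[h hP] := fun n => invn_lt (eps0 n).
have [c cP] := Y0 (fun n => (h n).+1).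
exists (fun n => [set y | Y y /\ eq_on 0 (h n).+1 (c n) y]); split.
  apply/seteqP; split=> [y Yy|y [n _ []//]].
  by have [n ny] := cP y Yy; exists n.
move=> n; apply: (@le_lt_trans _ _ ((h n).+1%:R^-1%:E)%R); last first.
  by rewrite lte_fin.
rewrite /diam ge_max lee_fin invr_ge0 ler0n /=.
apply: ge_ereal_sup => _ [x [_ cx] [y [_ cy] <-]].
rewrite lee_fin ltW//; apply/mdist_eq_on => i m im.
by rewrite -cx// cy.
Qed.

(** Cover [Y] once for each [N], and use indices coding pairs [(N, j)]: each
point of [Y] is then caught once for every [N], at an index above [N]. *)
Lemma cylinder_null_io k (Y : set (cantor_pow k)) : cylinder_null Y ->
  forall h : nat -> nat, exists c : nat -> cantor_pow k,
    forall y, Y y -> forall N, exists2 n, (N <= n)%N & eq_on 0 (h n) (c n) y.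
Proof.
move=> Y0 h.
have /choice[c cP] := fun N => Y0 (fun j => h (CodeSeq.code [:: N; j])).
exists (fun n => if CodeSeq.decode n is [:: N; j] then c N j else point).
move=> y Yy N; have [j jP] := cP N y Yy.
exists (CodeSeq.code [:: N; j]); last by rewrite CodeSeq.codeK.
by have /andP[/ltnW] := CodeSeq.ltn_code [:: N; j].
Qed.

(** * Meager sets miss a pattern infinitely repeated *)

(** One block [w] on [[a, b)] can serve finitely many prefixes and nowhere
dense sets at once: lengthening the block for one more pair keeps what was
gained for the others. *)
Lemma nowhere_dense_avoid (R : realType) k
    (L : seq (cantor_pow k * set (cantor_pow k))) a :
  (forall p, p \in L -> nowhere_dense p.2) ->
  exists b w, forall p, p \in L ->
    forall z, eq_on 0 a p.1 z -> eq_on a b w z -> ~ p.2 z.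
Proof.
elim: L => [|[s A] L IH] nd; first by exists 0%N, point.
have [|b [w wL]] := IH; first by move=> p pL; apply: nd; rewrite inE pL orbT.
have /(nowhere_denseP R) := nd (s, A) (mem_head _ _).
move=> /(_ (splice a s w) (maxn a b)) [y [m [yP mP]]].
exists (maxn b m), y => p; rewrite inE => /predU1P[-> /=|pL] z pz yz.
  apply: mP => i n /andP[_ nm].
  have [na|an] := ltnP n a; last first.
    by rewrite yz// an (leq_trans nm)// leq_maxr.
  by rewrite -yP ?leq_max ?na// /splice na pz.
apply: (wL p pL z pz) => i n /andP[an nb].
rewrite -yz ?an ?(leq_trans nb) ?leq_maxl//.
by rewrite -yP ?leq_max ?nb ?orbT// /splice ltnNge an.
Qed.

Section strictly_increasing.
Variables (e : nat -> nat) (einc : forall n, (e n < e n.+1)%N).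

Lemma strict_inc_lt m n : (e m < e n)%N = (m < n)%N.
Proof.
have eh := homo_ltn ltn_trans einc.
case: (ltngtP m n) => [/eh//|/eh/ltnW nm|->]; last by rewrite ltnn.
by rewrite ltnNge nm.
Qed.

Lemma strict_inc_le m n : (e m <= e n)%N = (m <= n)%N.
Proof. by rewrite leqNgt strict_inc_lt -leqNgt. Qed.

Lemma strict_inc_ge n : (n <= e n)%N.
Proof. by elim: n => // n IH; exact: leq_ltn_trans (einc n). Qed.

Lemma strict_inc_block m n n' :
  (e n <= m < e n.+1)%N -> (e n' <= m < e n'.+1)%N -> n = n'.
Proof.
move=> /andP[nm mn] /andP[n'm mn']; apply/eqP; rewrite eqn_leq.
apply/andP; split; rewrite -ltnS -strict_inc_lt.
  exact: leq_ltn_trans nm mn'.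
exact: leq_ltn_trans n'm mn.
Qed.

End strictly_increasing.

(** The block number [n] is chosen by [nowhere_dense_avoid] against all the
prefixes below [f (g n)] and the first [n + 1] nowhere dense sets composing
[M].  A point of the [N]-th of them can then match no block from [N] on.
Block ends are only ever pushed further, so they can be taken among the values
of [f]. *)
Lemma meager_avoid (R : realType) k (M : set (cantor_pow k)) (f : nat -> nat) :
  meager M -> (forall j, (f j < f j.+1)%N) ->
  exists (g : nat -> nat) (w : cantor_pow k),
    (forall n, (g n < g n.+1)%N) /\
    forall z, M z -> exists N, forall n, (N <= n)%N ->
      ~ eq_on (f (g n)) (f (g n.+1)) w z.
Proof.
move=> [F [Fnd ->]] finc.
have step (nj : nat * nat) : exists jw : nat * cantor_pow k,
    (nj.2 < jw.1)%N /\ forall i z, (i <= nj.1)%N ->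
      eq_on (f nj.2) (f jw.1) jw.2 z -> ~ F i z.
  case: nj => n j /=.
  pose L := [seq (s, F i) | s <- prefixes k (f j), i <- iota 0 n.+1].
  have [|b [w wL]] := @nowhere_dense_avoid R k L (f j).
    by move=> p /allpairsP[[s i] [_ _ ->]]; exact: Fnd.
  exists (maxn j.+1 b, w); split=> [|i z ilen wz] /=; first by rewrite leq_maxl.
  have [q qs qz] := prefixesP (f j) z.
  apply: (wL (nth point (prefixes k (f j)) q, F i)).
  - apply/allpairsP; exists (nth point (prefixes k (f j)) q, i).
    by rewrite mem_nth// mem_iota ltnS.
  - by move=> c m cm /=; rewrite qz.
  - apply: eq_on_sub wz => //=.
    by rewrite (leq_trans _ (strict_inc_ge finc _))// leq_maxr.
have /choice[S SP] := step.
pose g := nat_rect (fun=> nat) 0%N (fun n j => (S (n, j)).1).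
have ginc n : (g n < g n.+1)%N by have [] := SP (n, g n).
have fginc n : (f (g n) < f (g n.+1))%N by rewrite strict_inc_lt.
pose inblk m : set nat := [set n | (f (g n) <= m < f (g n.+1))%N].
(* The block containing position [m]; arbitrary below [f (g 0)], which no
   block reaches. *)
pose blk m := xget 0%N (inblk m).
exists g, (fun i m => (S (blk m, g (blk m))).2 i m); split=> //.
move=> z [N _ Nz]; exists N => n Nn wz.
have [_ /(_ N z Nn)] := SP (n, g n); apply=> // i m nm.
rewrite -wz//; suff -> : blk m = n by [].
apply: (strict_inc_block fginc _ nm).
exact: (xgetPex 0%N (ex_intro (inblk m) n nm)).
Qed.

(** * The matching property of meager-additive sets *)

Definition ev_nonzero k (f : nat -> nat) : set (cantor_pow k) :=
  [set z | exists N, forall j, (N <= j)%N ->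
     ~ eq_on (f j) (f j.+1) (fun _ _ => false) z].

Lemma meager_ev_nonzero (R : realType) k (f : nat -> nat) :
  (forall j, (f j < f j.+1)%N) -> meager (@ev_nonzero k f).
Proof.
move=> finc.
exists (fun N => [set z | forall j, (N <= j)%N ->
  ~ eq_on (f j) (f j.+1) (fun _ _ => false) z]); split; last first.
  by apply/seteqP; split=> [z [N Nz]|z [N _ Nz]]; exists N.
move=> N; apply/(nowhere_denseP R) => x n.
exists (splice n x (fun _ _ => false)), (f (maxn N n).+1).
split=> [|z xz /(_ (maxn N n))]; first exact: eq_on_splicel.
apply=> [|i m /andP[nm mn]]; first exact: leq_maxl.
rewrite -xz// /splice ltnNge (leq_trans _ nm)//.
by rewrite (leq_trans _ (strict_inc_ge finc _))// leq_maxr.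
Qed.

(** Let [g] and [w] be given by [meager_avoid] for the meager set
[X + ev_nonzero f].  If [x] differed from [w] on every interval of infinitely
many blocks, then setting [z] to [x + w] on these bad blocks and to [1]
elsewhere would give a point of [ev_nonzero f]; but [x + z] agrees with [w] on
every bad block, against the choice of [w]. *)
Lemma meager_additive_match (R : realType) k (X : set (cantor_pow k))
    (f : nat -> nat) : (0 < k)%N ->
  meager_additive X -> (forall j, (f j < f j.+1)%N) ->
  exists (g : nat -> nat) (w : cantor_pow k),
    (forall n, (g n < g n.+1)%N) /\
    forall x, X x -> exists N, forall n, (N <= n)%N ->
      exists2 j, (g n <= j < g n.+1)%N & eq_on (f j) (f j.+1) w x.
Proof.
move=> k0 Xadd finc.
have XM := Xadd _ (meager_ev_nonzero R k finc).
have [g [w [ginc gw]]] := meager_avoid R XM finc.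
exists g, w; split=> // x Xx.
pose bad n := forall j, (g n <= j < g n.+1)%N -> ~ eq_on (f j) (f j.+1) w x.
pose inbad m := `[< exists2 n, bad n & (f (g n) <= m < f (g n.+1))%N >].
pose z : cantor_pow k := fun i m => if inbad m then x i m (+) w i m else true.
have zM : ev_nonzero f z.
  exists 0%N => j _ z0.
  have /asboolP[n nbad] : inbad (f j).
    (* Outside the bad blocks [z] is constantly 1; this needs a coordinate. *)
    apply/negPn/negP => /negbTE jbad.
    have := z0 (Ordinal k0) (f j); rewrite leqnn finc /z jbad.
    by move=> /(_ isT).
  rewrite strict_inc_le// strict_inc_lt// => nj.
  apply: (nbad j nj) => i m jm; have := z0 i m jm; rewrite /z.
  have -> : inbad m.
    apply/asboolP; exists n => //; move: nj jm => /andP[nj jn] /andP[jm mj].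
    rewrite (leq_trans _ jm) ?(leq_trans mj)// strict_inc_le//.
  by case: (x i m) (w i m) => [] [].
have [|N Nxz] := gw (cantor_xor x z); first by exists x => //; exists z.
exists N => n Nn; apply: contrapT => nj.
apply: (Nxz n Nn) => i m nm; rewrite /cantor_xor /z.
have -> : inbad m.
  by apply/asboolP; exists n => // j jn jwx; apply: nj; exists j.
by rewrite addKb.
Qed.

(** * Products *)

Lemma eq_on_concat k l n (x x' : cantor_pow k) (y y' : cantor_pow l) :
  eq_on 0 n x x' -> eq_on 0 n y y' ->
  eq_on 0 n (cantor_concat (x, y)) (cantor_concat (x', y')).
Proof.
move=> xx yy i m mn; rewrite /cantor_concat.
by case: fintype.split => j /=; [exact: xx|exact: yy].
Qed.

(** The cylinder indexed by the code of [n, j, i] is the product of the [i]-th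
prefix of length [f j] continued by [w] with the [n]-th cylinder [t n] covering
[Y].  Putting [n] in the index spares computing the block of [j], and costs
only finitely many indices for each [j] since block [n] starts at [n] or
later. *)
Lemma cylinder_null_concat (R : realType) k l (X : set (cantor_pow k))
    (Y : set (cantor_pow l)) : (0 < k)%N ->
  meager_additive X -> cylinder_null Y ->
  cylinder_null (@cantor_concat k l @` (X `*` Y)).
Proof.
move=> k0 Xadd Y0 h.
pose next j a := (a + \max_(n < j.+1) \max_(i < size (prefixes k a))
  h (CodeSeq.code [:: n : nat; j; i : nat])).+1.
pose f := nat_rect (fun=> nat) 0%N next.
have finc j : (f j < f j.+1)%N by rewrite ltnS leq_addr.
have fh n j i : (n <= j)%N -> (i < size (prefixes k (f j)))%N ->
    (h (CodeSeq.code [:: n; j; i]) <= f j.+1)%N.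
  move=> nj ik; apply: leqW; apply: leq_trans (leq_addl _ _).
  apply: (@bigop.bigmax_sup _ (Ordinal (nj : n < j.+1)%N)) => //.
  exact: (@bigop.bigmax_sup _ (Ordinal ik)).
have [g [w [ginc gw]]] := meager_additive_match R k0 Xadd finc.
have [t tP] := cylinder_null_io Y0 (fun n => f (g n.+1)).
exists (fun q => if CodeSeq.decode q is [:: n; j; i] then
  cantor_concat (splice (f j) (nth point (prefixes k (f j)) i) w, t n)
  else point).
move=> _ [[x y] [/= Xx Yy] <-].
have [N Nx] := gw x Xx.
have [n Nn ny] := tP y Yy N.
have [j /andP[nj jn] jx] := Nx n Nn.
have [i ik ix] := prefixesP (f j) x.
have nlej : (n <= j)%N := leq_trans (strict_inc_ge ginc n) nj.
exists (CodeSeq.code [:: n; j; i]); rewrite CodeSeq.codeK.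
apply: (@eq_on_sub _ 0 (f j.+1)) => //; first exact: fh.
apply: eq_on_concat; last first.
  by apply: eq_on_sub ny => //; rewrite strict_inc_le.
move=> c m /andP[_ mj]; rewrite /splice; case: ltnP => jm.
  by rewrite -ix.
by apply: jx; rewrite jm.
Qed.

Theorem theorem1p15 (R : realType) (k l : nat) (k_ge1 : (1 <= k)%N)
    (l_ge1 : (1 <= l)%N) (X : set (cantor_pow k)) (Y : set (cantor_pow l)) :
  meager_additive X -> strong_measure_zero R Y ->
  strong_measure_zero R (@cantor_concat k l @` (X `*` Y)).
Proof.
move=> Xadd /strong_measure_zeroP Y0.
by apply/strong_measure_zeroP; exact: (cylinder_null_concat R).
Qed.
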